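(* For every set $\Gamma$ of formulas of $\mathcal{L}_{\mathsf{DPL}}$ and all formulas $\varphi,\psi$, we have $\Gamma\cup\{\varphi\}\vdash\psi$ if and only if $\Gamma\vdash\varphi\to\psi$, where $\vdash$ is derivability in $\mathcal{H}^{-}_{\mathsf{DPL}}$.
   Context: Let $\mathbb{P}$ be a countable set of propositional variables. The formulas of $\mathcal{L}_{\mathsf{DPL}}$ are given by $\varphi ::= p \mid \neg\varphi \mid \varphi\wedge\varphi \mid L_r\varphi \mid \bigcirc\varphi$ with $p\in\mathbb{P}$, $r\in\mathbb{Q}\cap[0,1]$; other Boolean connectives are abbreviations, $\bigcirc^n$ is $n$-fold iteration of $\bigcirc$. The Hilbert system $\mathcal{H}^{-}_{\mathsf{DPL}}$ has the axiom schemes: all propositional tautologies; $L_0\bot$; $L_r\neg\varphi\to\neg L_s\varphi$ if $r+s>1$; $L_r(\varphi\wedge\psi)\wedge L_s(\varphi\wedge\neg\psi)\to L_{r+s}\varphi$ if $r+s\le 1$; $\neg L_r(\varphi\wedge\psi)\wedge\neg L_s(\varphi\wedge\neg\psi)\to\neg L_{r+s}\varphi$ if $r+s\le1$; $L_1(\varphi\to\psi)\to(L_r\varphi\to L_r\psi)$; $\bigcirc\neg\varphi\leftrightarrow\neg\bigcirc\varphi$; $\bigcirc(\varphi\wedge\psi)\leftrightarrow(\bigcirc\varphi\wedge\bigcirc\psi)$; and the rules: modus ponens; the Archimedean rule: from $\{\psi\to\bigcirc^nL_s\varphi \mid s<r,\ s\in\mathbb{Q}\cap[0,1]\}$ infer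 $\psi\to\bigcirc^nL_r\varphi$ (each $n\in\mathbb{N}$); necessitation: from $\varphi$ infer $L_1\varphi$; from $\varphi$ infer $\bigcirc\varphi$. A theorem ($\vdash\varphi$) is the last element of a sequence $(\varphi_\beta)_{\beta\le\alpha+1}$, $\alpha$ a countable ordinal, each element being an axiom or obtained by a rule from (possibly infinitely many) earlier elements. $\Gamma\vdash\varphi$ means there is such a sequence ending in $\varphi$ each element of which is a member of $\Gamma$, a theorem, or obtained from earlier elements by a rule other than the two necessitation rules. *)

(* Defs.v *)
From mathcomp Require Import all_boot all_order all_algebra.
From mathcomp Require Import interval_inference.
From mathcomp Require Import boolp classical_sets cardinality wochoice.

Set Implicit Arguments.
Unset Strict Implicit.
Unset Printing Implicit Defensive.

Import Order.TTheory GRing.Theory Num.Theory.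

Local Open Scope classical_set_scope.
Local Open Scope ring_scope.

Inductive dpl_formula (P : Type) : Type :=
| Var of P
| Neg of dpl_formula P
| And of dpl_formula P & dpl_formula P
| L of {i01 rat} & dpl_formula P
| Next of dpl_formula P.

Section Syntax.
Context {P : Type}.
Implicit Types phi psi : dpl_formula P.

Definition Imp phi psi := Neg (And phi (Neg psi)).
Definition Iff phi psi := And (Imp phi psi) (Imp psi phi).

(* Falsity is not primitive: it is a contradiction on some variable p. *)
Definition Bot (p : P) : dpl_formula P := And (Var p) (Neg (Var p)).

Definition Nexts (n : nat) phi : dpl_formula P := iter n (@Next P) phi.

(* Boolean evaluation in which every formula whose main connective is neither
   Neg nor And counts as an atom, with truth value given by v. *)
Fixpoint beval (v : dpl_formula P -> bool) phi : bool :=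
  match phi with
  | Neg psi => ~~ beval v psi
  | And psi chi => beval v psi && beval v chi
  | _ => v phi
  end.

Definition tautology phi := forall v, beval v phi.

End Syntax.

Definition add01 (r s : {i01 rat}) (rs : r%:num + s%:num <= 1) : {i01 rat} :=
  Itv01 (addr_ge0 (ge0 r) (ge0 s)) rs.

Inductive dpl_axiom (P : Type) : dpl_formula P -> Prop :=
| ax_taut phi : tautology phi -> dpl_axiom phi
| ax_bot p : dpl_axiom (L 0%:i01 (Bot p))
| ax_neg r s phi : 1 < r%:num + s%:num ->
    dpl_axiom (Imp (L r (Neg phi)) (Neg (L s phi)))
| ax_add r s (rs : r%:num + s%:num <= 1) phi psi :
    dpl_axiom (Imp (And (L r (And phi psi)) (L s (And phi (Neg psi))))
               (L (add01 rs) phi))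
| ax_sub r s (rs : r%:num + s%:num <= 1) phi psi :
    dpl_axiom (Imp (And (Neg (L r (And phi psi)))
                        (Neg (L s (And phi (Neg psi)))))
               (Neg (L (add01 rs) phi)))
| ax_mono r phi psi :
    dpl_axiom (Imp (L 1%:i01 (Imp phi psi)) (Imp (L r phi) (L r psi)))
| ax_next_neg phi : dpl_axiom (Iff (Next (Neg phi)) (Neg (Next phi)))
| ax_next_and phi psi :
    dpl_axiom (Iff (Next (And phi psi)) (And (Next phi) (Next psi))).

(* In the rules, E is the set of formulas available as premises. *)
Inductive rule (P : Type) (E : set (dpl_formula P)) : dpl_formula P -> Prop :=
| modus_ponens phi psi : E phi -> E (Imp phi psi) -> rule E psi
| archimedean psi n r phi :
    (forall s : {i01 rat}, s%:num < r%:num ->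
      E (Imp psi (Nexts n (L s phi)))) ->
    rule E (Imp psi (Nexts n (L r phi))).

Inductive necessitation (P : Type) (E : set (dpl_formula P)) :
    dpl_formula P -> Prop :=
| nec_L phi : E phi -> necessitation E (L 1%:i01 phi)
| nec_Next phi : E phi -> necessitation E (Next phi).

(* Countable ordinals, represented by well-orders on countable types. *)
Record countable_ordinal := CountableOrdinal {
  ord_car : Type;
  ord_le : rel ord_car;
  ord_wo : well_order ord_le;
  ord_countable : countable [set: ord_car]
}.

(* Adds the greatest element None to an order. *)
Definition succ_le (W : Type) (R : rel W) : rel (option W) := fun x y =>
  match x, y with
  | _, None => true
  | None, Some _ => false
  | Some a, Some b => R a b
  end.

(* The ordinals beta <= alpha + 1: Some (Some _) are those below alpha,
   Some None is alpha and None is alpha + 1. *)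
Definition upto_succ (alpha : countable_ordinal) :=
  option (option (ord_car alpha)).

(* The ordering being total, b < c is the negation of c <= b. *)
Definition upto_succ_lt (alpha : countable_ordinal) : rel (upto_succ alpha) :=
  fun b c => ~~ succ_le (succ_le (@ord_le alpha)) c b.

(* phi ends a sequence indexed by the beta <= alpha + 1, alpha a countable
   ordinal, each element of which is justified (in the sense of step) by the
   set of the elements before it. *)
Definition ends_sequence (P : Type)
    (step : set (dpl_formula P) -> dpl_formula P -> Prop)
    (phi : dpl_formula P) : Prop :=
  exists (alpha : countable_ordinal) (f : upto_succ alpha -> dpl_formula P),
    f None = phi /\
    forall b, step [set f c | c in [set c | upto_succ_lt c b]] (f b).

Definition thm (P : Type) (phi : dpl_formula P) : Prop :=
  ends_sequence
    (fun E chi => [\/ dpl_axiom chi, rule E chi | necessitation E chi]) phi.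

Definition derives (P : Type) (Gamma : set (dpl_formula P))
    (phi : dpl_formula P) : Prop :=
  ends_sequence (fun E chi => [\/ Gamma chi, thm chi | rule E chi]) phi.

(* Main.v *)
(* Membership of the set of last elements of sequences is inductive: in a
   sequence ending outside a set closed under the steps there would be a least
   element outside it. Conversely, countably many sequences can be concatenated
   into one of countable length, so derivability is closed under the rules, the
   Archimedean rule included since it has countably many premises. The
   deduction theorem is then an induction on derivations: the Archimedean rule
   commutes with the extra hypothesis phi because phi -> (psi -> chi) is
   equivalent to phi /\ psi -> chi and psi in that rule is arbitrary, and
   the necessitation rules occur only inside theorems. *)
Require Import Defs.
From mathcomp Require Import all_boot classical_sets.
From mathcomp Require Import all_algebra interval_inference.
From mathcomp Require Import boolp cardinality wochoice.

Set Implicit Arguments.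
Unset Strict Implicit.
Unset Printing Implicit Defensive.

Local Open Scope classical_set_scope.

(** * Well-orders as unique minima, and adjoining a top element *)

Section WellOrders.
Context {T : Type} {R : rel T}.

Lemma well_order_min : well_order R ->
  forall Q : set T, Q !=set0 -> exists2 x, Q x & forall y, Q y -> R x y.
Proof.
move=> Rwo Q [x Qx]; have [|z [[Qz lbz] _]] := Rwo (fun x => `[<Q x>]).
  by exists x; apply/asboolP.
by exists z => [|y Qy]; [exact/asboolP | apply/lbz/asboolP].
Qed.

Lemma well_order_refl : well_order R -> reflexive R.
Proof.
move=> Rwo x.
by have [|y -> ->] := well_order_min Rwo (Q := [set x]); first exists x.
Qed.

(** If [x] and [y] lie below each other, both are minima of the pair of them, and minima are
    unique. *)
Lemma well_order_anti : well_order R -> antisymmetric R.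
Proof.
move=> Rwo x y /andP[Rxy Ryx].
have [|z [_ Uz]] := Rwo (fun z => `[<z = x \/ z = y>]).
  by exists x; apply/asboolP; left.
have Rx := well_order_refl Rwo.
have zx : z = x.
  by apply: Uz; split; [apply/asboolP; left | move=> w /asboolP[]->].
have zy : z = y.
  by apply: Uz; split; [apply/asboolP; right | move=> w /asboolP[]->].
by rewrite -zx zy.
Qed.

Lemma min_well_order : antisymmetric R ->
  (forall Q : set T, Q !=set0 -> exists2 x, Q x & forall y, Q y -> R x y) ->
  well_order R.
Proof.
move=> Ranti Rmin; apply: antisymmetric_well_order => // A [x Ax].
have [|z Az lbz] := Rmin (fun x => x \in A); first by exists x.
by exists z; split.
Qed.

End WellOrders.

Lemma succ_le_well_order (W : Type) (R : rel W) :
  well_order R -> well_order (succ_le R).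
Proof.
move=> Rwo; apply: min_well_order => [[x|] [y|] //= /(well_order_anti Rwo)->//|].
move=> Q [z Qz].
(* The top [None] is the minimum of [Q] only when [Q] has no other element. *)
have [[x Qx]|noQ] := pselect (exists x, Q (Some x)).
  have [|m Qm lbm] := well_order_min Rwo (Q := fun x => Q (Some x)).
    by exists x.
  by exists (Some m) => // -[y /lbm|].
case: z Qz => [z Qz|QN]; first by case: noQ; exists z.
by exists None => // -[y Qy|//]; case: noQ; exists y.
Qed.

(** * Countable lexicographic sums of well-orders *)

Section LexicographicSum.
Context {I : countType} {U : I -> Type} (R : forall i, rel (U i)).

(** Comparing indices by their codes makes the index type inherit the well-order of the natural
    numbers. *)
Definition lex_le : rel {i : I & U i} := fun x y =>
  (pickle (tag x) < pickle (tag y))%N ||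
  (tag x == tag y) && R (tagged x) (tagged_as x y).

Lemma lex_le_Tagged i (a b : U i) :
  lex_le (Tagged U a) (Tagged U b) = R a b.
Proof. by rewrite /lex_le /= ltnn eqxx tagged_asE. Qed.

Lemma lex_le_well_order :
  (forall i, well_order (R (i := i))) -> well_order lex_le.
Proof.
move=> Rwo; apply: min_well_order => [[i a] [j b]|Q [[i a] Qa]].
  have [eq_ij|neq_ij] := eqVneq i j.
    case: j / eq_ij b => b.
    by rewrite !lex_le_Tagged => /(well_order_anti (Rwo i)) ->.
  rewrite /lex_le /= (eq_sym j) (negPf neq_ij) !orbF => /andP[lt_ij lt_ji].
  by have := ltn_trans lt_ij lt_ji; rewrite ltnn.
(* [D] holds of the codes of the components that [Q] meets; its least element selects the component
   in which to minimise. *)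
pose D n := `[< exists2 x, Q x & pickle (tag x) = n >].
have exD : exists n, D n by exists (pickle i); apply/asboolP; exists (Tagged U a).
case: (ex_minnP exD) => n /asboolP[[j b] Qb /= <-] minj.
have [|m Qm lbm] := well_order_min (Rwo j) (Q := fun c => Q (Tagged U c)).
  by exists b.
exists (Tagged U m) => // -[k c] Qc.
have [lt_jk||eq_jk] := ltngtP (pickle j) (pickle k).
- by rewrite /lex_le /= lt_jk.
- by rewrite ltnNge minj //; apply/asboolP; exists (Tagged U c).
- move/(pcan_inj pickleK): eq_jk => eq_jk; case: k / eq_jk c Qc => c Qc.
  by rewrite lex_le_Tagged lbm.
Qed.

End LexicographicSum.

Lemma countable_sigma (I : countType) (U : I -> Type) :
  (forall i, countable [set: U i]) -> countable [set: {i : I & U i}].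
Proof.
move=> Uc.
have h i : {h : U i -> nat | injective h}.
  apply: cid; have /countable_injP[h hinj] := Uc i.
  by exists h => x y; apply: hinj; rewrite inE.
apply/countable_injP; exists (fun x => pickle (tag x, sval (h _) (tagged x))).
move=> [i a] [j b] _ _ /(pcan_inj pickleK)[/= eq_ij].
by case: j / eq_ij b => b /(svalP (h i)) ->.
Qed.

Lemma countable_option (T : Type) :
  countable [set: T] -> countable [set: option T].
Proof.
move=> /countable_injP[h hinj].
apply/countable_injP; exists (fun x => pickle (omap h x)).
move=> [x|] [y|] _ _ /(pcan_inj pickleK) //= [/hinj->//]; rewrite inE //.
Qed.

(** * Sequences of formulas indexed by countable ordinals *)

Section Sequences.
Context {P : Type}.
Variable step : set (dpl_formula P) -> dpl_formula P -> Prop.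

Lemma ends_sequence_ind (Q : set (dpl_formula P)) :
  (forall E chi, E `<=` Q -> step E chi -> Q chi) -> ends_sequence step `<=` Q.
Proof.
move=> Qstep _ [alpha [f [<- fstep]]].
have wo := succ_le_well_order (succ_le_well_order (@ord_wo alpha)).
apply: contrapT => nQ.
have [|b nQb minb] := well_order_min wo (Q := fun b => ~ Q (f b)).
  by exists None.
apply/nQb/(Qstep _ _ _ (fstep b)) => _ [c /= ltcb <-].
by apply: contrapT => /minb; apply/negP.
Qed.

Hypothesis step_mono :
  forall (E E' : set (dpl_formula P)) chi, E `<=` E' -> step E chi -> step E' chi.

(* Concatenate countably many sequences into one, whose index set is the
   lexicographic sum of theirs; the elements at both alpha and alpha + 1 are
   then the new formula, justified by the ends of the given sequences. *)
Lemma ends_sequence_step (I : Type) (g : I -> dpl_formula P) chi :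
  countable [set: I] -> (forall i, ends_sequence step (g i)) ->
  step (range g) chi -> ends_sequence step chi.
Proof.
(* Countability is traded for a [countType] structure, whose codes will order the components. *)
move=> /Pcountable[J eqIJ]; subst I; rename J into I => gseq gchi.
have /choice[F HF] i : exists F : {alpha & upto_succ alpha -> dpl_formula P},
    tagged F None = g i /\
    forall b, step [set tagged F c | c in [set c | upto_succ_lt c b]] (tagged F b).
  by have [alpha [f ?]] := gseq i; exists (Tagged _ f).
pose U i := upto_succ (tag (F i)).
pose R i : rel (U i) := succ_le (succ_le (@ord_le (tag (F i)))).
have lex_wo : well_order (lex_le R).
  by apply: lex_le_well_order => i; do 2!apply: succ_le_well_order; exact: ord_wo.
have lex_count : countable [set: {i : I & U i}].
  by apply: countable_sigma => i; do 2!apply: countable_option; exact: ord_countable.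
pose alpha := CountableOrdinal lex_wo lex_count.
pose f (b : upto_succ alpha) :=
  if b is Some (Some x) then tagged (F (tag x)) (tagged x) else chi.
have f_chi b : (forall x, upto_succ_lt (Some (Some x)) b) ->
    step [set f c | c in [set c | upto_succ_lt c b]] chi.
  move=> ltb; apply: step_mono gchi => _ [i _ <-].
  have [<- _] := HF i.
  (* The formula [g i] stands at the top of the component of [i]. *)
  by exists (Some (Some (Tagged U (None : U i)))) => //; exact: ltb.
exists alpha, f; split=> // -[[[i b]|]|]; try exact: f_chi.
(* What precedes [b] in its own component still precedes it in the sum; the further predecessors do
   no harm, by [step_mono]. *)
have [_ /(_ b)] := HF i; apply: step_mono => _ [c ltcb <-].
exists (Some (Some (Tagged U (c : U i)))) => //.
by rewrite /= /upto_succ_lt /= lex_le_Tagged.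
Qed.

End Sequences.

(** * Closure of derivability under the rules, and the deduction theorem *)

Section Derivability.
Context {P : Type}.
Implicit Types (Gamma E : set (dpl_formula P)) (phi psi chi : dpl_formula P).

Lemma rule_mono E E' chi : E `<=` E' -> rule E chi -> rule E' chi.
Proof.
move=> sEE' [phi psi /sEE' Ephi /sEE' Eimp|psi n r phi Earch].
  exact: modus_ponens Ephi Eimp.
by apply: archimedean => s /Earch/sEE'.
Qed.

Lemma tautology_thm phi : tautology phi -> thm phi.
Proof.
(* An axiom needs no premises, so the empty family of sequences suffices. *)
move=> taut; apply: (@ends_sequence_step _ _ _ void (fun i => match i with end)).
- move=> E E' chi sEE' [ax|ru|[{}chi Echi|{}chi Echi]].
  + exact: Or31.
  + by apply/Or32/(rule_mono sEE').
  + by apply/Or33/nec_L/sEE'.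
  + by apply/Or33/nec_Next/sEE'.
- exact: countableP.
- by case.
- exact/Or31/ax_taut.
Qed.

Lemma derives_step Gamma (I : Type) (g : I -> dpl_formula P) chi :
  countable [set: I] -> (forall i, derives Gamma (g i)) ->
  [\/ Gamma chi, thm chi | rule (range g) chi] -> derives Gamma chi.
Proof.
apply: ends_sequence_step => E E' {}chi sEE' [Gchi|tchi|rchi].
- exact: Or31.
- exact: Or32.
- exact/Or33/(rule_mono sEE').
Qed.

Lemma derives_assum Gamma chi : Gamma chi -> derives Gamma chi.
Proof.
move=> Gchi; apply: (@derives_step _ void (fun i => match i with end)).
- exact: countableP.
- by case.
- exact: Or31.
Qed.

Lemma derives_thm Gamma chi : thm chi -> derives Gamma chi.
Proof.
move=> tchi; apply: (@derives_step _ void (fun i => match i with end)).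
- exact: countableP.
- by case.
- exact: Or32.
Qed.

Lemma derives_mp Gamma phi psi :
  derives Gamma phi -> derives Gamma (Imp phi psi) -> derives Gamma psi.
Proof.
move=> Dphi Dimp.
apply: (@derives_step _ bool (fun b => if b then phi else Imp phi psi)).
- exact: countableP.
- by case.
- by apply/Or33/(@modus_ponens _ _ phi); [exists true | exists false].
Qed.

Lemma derives_archimedean Gamma psi n (r : {i01 rat}) phi :
  (forall s : {i01 rat}, (s%:num < r%:num)%R ->
    derives Gamma (Imp psi (Nexts n (L s phi)))) ->
  derives Gamma (Imp psi (Nexts n (L r phi))).
Proof.
move=> Dpsi.
(* One sequence for each rational below [r]: the premises form a countable family. *)
apply: (@derives_step _ {s : {i01 rat} | (s%:num < r%:num)%R}
  (fun s => Imp psi (Nexts n (L (sval s) phi)))).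
- apply/countable_injP; exists (fun s => pickle ((sval s)%:num : rat)%R).
  move=> [s sr] [t tr] _ _ /(pcan_inj pickleK) /= st.
  by apply/val_inj/val_inj.
- by case=> s sr; exact: Dpsi.
- by apply/Or33/archimedean => s sr; exists (exist _ s sr).
Qed.

(** Theorems count as leaves here, so the induction never meets a necessitation step. *)
Lemma derives_ind Gamma (Q : set (dpl_formula P)) :
  Gamma `<=` Q -> @thm P `<=` Q -> (forall chi, rule Q chi -> Q chi) ->
  derives Gamma `<=` Q.
Proof.
move=> GQ tQ rQ; apply: ends_sequence_ind => E chi EQ [/GQ|/tQ|] //.
by move=> /(rule_mono EQ)/rQ.
Qed.

Lemma derives_mono Gamma Gamma' :
  Gamma `<=` Gamma' -> derives Gamma `<=` derives Gamma'.
Proof.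
move=> sGG'; apply: derives_ind => [chi /sGG'|chi|_ [phi psi|psi n r phi]].
- exact: derives_assum.
- exact: derives_thm.
- exact: derives_mp.
- exact: derives_archimedean.
Qed.

Lemma derives_taut_mp Gamma phi psi :
  tautology (Imp phi psi) -> derives Gamma phi -> derives Gamma psi.
Proof. by move=> /tautology_thm/derives_thm D /derives_mp; apply. Qed.

Lemma derives_taut_mp2 Gamma phi psi chi :
  tautology (Imp phi (Imp psi chi)) ->
  derives Gamma phi -> derives Gamma psi -> derives Gamma chi.
Proof. by move=> taut /(derives_taut_mp taut) D /derives_mp; apply. Qed.

Lemma derives_curry Gamma phi psi chi :
  derives Gamma (Imp phi (Imp psi chi)) <->
  derives Gamma (Imp (And phi psi) chi).
Proof.
by split; apply: derives_taut_mp => v /=;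
  case: (beval v phi); case: (beval v psi); case: (beval v chi).
Qed.

Lemma derives_deduction Gamma phi psi :
  derives (Gamma `|` [set phi]) psi -> derives Gamma (Imp phi psi).
Proof.
have weaken chi : derives Gamma chi -> derives Gamma (Imp phi chi).
  by apply: derives_taut_mp => v /=; case: (beval v phi); case: (beval v chi).
move: psi; apply: derives_ind => [chi [/derives_assum/weaken//|->]|chi|].
- by apply/derives_thm/tautology_thm => v /=; case: (beval v phi).
- by move=> /(@derives_thm Gamma)/weaken.
- move=> _ [psi chi|psi n r chi] /=.
    (* Modus ponens under the hypothesis [phi] is the distribution of [phi] over an implication. *)
    apply: derives_taut_mp2 => v /=.
    by case: (beval v phi); case: (beval v psi); case: (beval v chi).
  (* The rule is applied with antecedent [And phi psi]. *)
  move=> Dpsi; apply/derives_curry/derives_archimedean => s /Dpsi.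
  by move/derives_curry.
Qed.

End Derivability.

Theorem theorem2p9 (P : countType) (Gamma : set (dpl_formula P))
    (phi psi : dpl_formula P) :
  derives (Gamma `|` [set phi]) psi <-> derives Gamma (Imp phi psi).
Proof.
split=> [|Dimp]; first exact: derives_deduction.
(* Conversely, [phi] is now an assumption and can be detached from the implication, which stays
   derivable from the larger set. *)
apply: (derives_mp (phi := phi)); first by apply: derives_assum; right.
exact: derives_mono Dimp => chi; left.
Qed.
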